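(* Let $A$ be an integral ring and $(s_1,\dots,s_n)$ a sequence in $A$ of depth $\geq 2$. Write $A_i=A[\frac1{s_i}]$. 1. (a) For $a,b\in A$: $a$ divides $b$ in $A$ if and only if $a$ divides $b$ in each $A_i$. (b) For $a,a_1,\dots,a_k\in A^*$: $a$ is a strong gcd of $(a_1,\dots,a_k)$ in $A$ if and only if $a$ is a strong gcd of $(a_1,\dots,a_k)$ in each $A_i$. (c) For $a_1,\dots,a_k\in A^*$: the ideal $\langle a_1,\dots,a_k\rangle$ is divisorially invertible in $A$ if and only if it is divisorially invertible in each $A_i$. 2. $A$ is integrally closed if and only if each ring $A_i$ is integrally closed. 3. $A$ is a ring with divisors if and only if each ring $A_i$ is a ring with divisors.
   Context: Rings are commutative with unit. A ring is integral if every element is zero or regular (the trivial ring is not excluded; in a trivial ring every element is regular); $A^*$ is the set of regular elements of $A$. An integral ring is integrally closed if it is integrally closed in its total ring of fractions. Depth: a list $(a_1,\dots,a_n)$ has depth $\ge1$ if $a_1x=\dots=a_nx=0$ implies $x=0$. It has depth $\ge2$ if moreover every list $(x_1,\dots,x_n)$ proportional to it (i.e. $a_ix_j=a_jx_i$ for all $i,j$) is a multiple of it (i.e. there is $x$ with $x_j=xa_j$ for all $j$). An element $g\in A^*$ is a strong gcd of $(a_1,\dots,a_k)$ in $A^*$ if for every $x\in A^*$, $xg$ is a gcd of $(xa_1,\dots,xa_k)$ in $A$. A list $(a_i)$ in $A^*$, or the ideal it generates, is divisorially invertible if there is a finite list $(b_j)$ in $A^*$ such that the family $(a_ib_j)_{i,j}$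 has a strong gcd in $A^*$ (this depends only on the ideal $\langle a_1,\dots,a_k\rangle$). An integral ring is a ring with divisors (PvMD) if every nonzero finitely generated ideal is divisorially invertible. *)

(* Defs.v *)
From HB Require Import structures.
From mathcomp Require Import all_boot all_order all_algebra.
From mathcomp Require Import generic_quotient ring boolp classical_sets.

Set Implicit Arguments.
Unset Strict Implicit.
Unset Printing Implicit Defensive.

Import GRing.Theory.
Local Open Scope ring_scope.
Local Open Scope quotient_scope.

(* Rings are [comPzRingType]s, so the trivial ring is allowed.  Regular
   elements are the elements x satisfying [GRing.lreg x], i.e. such that
   multiplication by x is injective. *)

(* The ring of fractions S^-1 A of a commutative ring A with respect to a
   multiplicative subset S; S may contain zero divisors, and even 0, in which
   case S^-1 A is trivial. *)
Module Loc.
Section Loc.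
Variables (A : comPzRingType) (S : mulrClosed A).

Definition pair := (A * {d : A | d \in S})%type.

Definition eqv (x y : pair) : bool :=
  `[< exists2 w : A, w \in S & w * (x.1 * val y.2) = w * (y.1 * val x.2) >].

Lemma eqv_refl : reflexive eqv.
Proof. by move=> x; apply/asboolP; exists 1; rewrite ?rpred1. Qed.

Lemma eqv_sym : symmetric eqv.
Proof. by move=> x y; apply/asboolP/asboolP => -[w wS e]; exists w. Qed.

Lemma eqv_trans : transitive eqv.
Proof.
move=> y x z /asboolP[w wS e] /asboolP[w' w'S e']; apply/asboolP.
exists (w * w' * val y.2); first by rewrite !rpredM ?(valP y.2).
transitivity (w' * val z.2 * (w * (x.1 * val y.2))); first by ring.
by rewrite e; transitivity (w * val x.2 * (w' * (y.1 * val z.2)));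
  [ring | rewrite e'; ring].
Qed.

Canonical eqv_equiv := EquivRel eqv eqv_refl eqv_sym eqv_trans.

Definition type := {eq_quot eqv}.
HB.instance Definition _ : EqQuotient _ eqv type := EqQuotient.on type.
HB.instance Definition _ := Choice.on type.

Definition den1 : {d : A | d \in S} := exist _ 1 (rpred1 _).
Definition denM (d e : {d : A | d \in S}) : {d : A | d \in S} :=
  exist _ (val d * val e) (rpredM (valP d) (valP e)).

Definition frac (a : A) (d : {d : A | d \in S}) : type := \pi_type (a, d).

Lemma frac_eq a d b e :
  frac a d = frac b e <->
  exists2 w : A, w \in S & w * (a * val e) = w * (b * val d).
Proof.
split; first by move/eqmodP/asboolP.
by move=> h; apply/eqmodP/asboolP.
Qed.

Lemma fracP (x : type) : exists a d, x = frac a d.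
Proof. by elim/quotW: x => -[a d]; exists a, d. Qed.

Definition add (x y : type) : type :=
  frac ((repr x).1 * val (repr y).2 + (repr y).1 * val (repr x).2)
       (denM (repr x).2 (repr y).2).
Definition opp (x : type) : type := frac (- (repr x).1) (repr x).2.
Definition mul (x y : type) : type :=
  frac ((repr x).1 * (repr y).1) (denM (repr x).2 (repr y).2).

Lemma repr_frac a d : exists2 w : A, w \in S &
  w * ((repr (frac a d)).1 * val d) = w * (a * val (repr (frac a d)).2).
Proof.
apply/(frac_eq (repr (frac a d)).1 (repr (frac a d)).2).
by rewrite [RHS](esym (reprK _)) /frac; case: (repr _).
Qed.

Lemma addE a d b e :
  add (frac a d) (frac b e) = frac (a * val e + b * val d) (denM d e).
Proof.
rewrite /add; have [w wS h] := repr_frac a d; have [v vS k] := repr_frac b e.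
move: (repr _) h => [a' d'] /= h; move: (repr _) k => [b' e'] /= k.
apply/frac_eq; exists (w * v); first by rewrite rpredM.
transitivity (v * val e' * val e * (w * (a' * val d))
            + w * val d' * val d * (v * (b' * val e))); first by rewrite /=; ring.
by rewrite h k /=; ring.
Qed.

Lemma mulE a d b e : mul (frac a d) (frac b e) = frac (a * b) (denM d e).
Proof.
rewrite /mul; have [w wS h] := repr_frac a d; have [v vS k] := repr_frac b e.
move: (repr _) h => [a' d'] /= h; move: (repr _) k => [b' e'] /= k.
apply/frac_eq; exists (w * v); first by rewrite rpredM.
transitivity ((w * (a' * val d)) * (v * (b' * val e))); first by rewrite /=; ring.
by rewrite h k /=; ring.
Qed.

Lemma oppE a d : opp (frac a d) = frac (- a) d.
Proof.
rewrite /opp; have [w wS h] := repr_frac a d.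
move: (repr _) h => [a' d'] /= h.
by apply/frac_eq; exists w => //; rewrite !mulNr !mulrN h.
Qed.

Let eqfrac a d b e : a * val e = b * val d -> frac a d = frac b e.
Proof. by move=> h; apply/frac_eq; exists 1; rewrite ?rpred1 ?h. Qed.

Lemma addA : associative add.
Proof.
move=> x y z; have [a [d ->]] := fracP x; have [b [e ->]] := fracP y.
by have [c [f ->]] := fracP z; rewrite !addE; apply: eqfrac => /=; ring.
Qed.

Lemma addC : commutative add.
Proof.
move=> x y; have [a [d ->]] := fracP x; have [b [e ->]] := fracP y.
by rewrite !addE; apply: eqfrac => /=; ring.
Qed.

Lemma add0 : left_id (frac 0 den1) add.
Proof.
by move=> x; have [a [d ->]] := fracP x; rewrite addE; apply: eqfrac => /=; ring.
Qed.

Lemma addN : left_inverse (frac 0 den1) opp add.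
Proof.
move=> x; have [a [d ->]] := fracP x.
by rewrite oppE addE; apply: eqfrac => /=; ring.
Qed.

HB.instance Definition _ := GRing.isZmodule.Build type addA addC add0 addN.

Lemma mulA : associative mul.
Proof.
move=> x y z; have [a [d ->]] := fracP x; have [b [e ->]] := fracP y.
by have [c [f ->]] := fracP z; rewrite !mulE; apply: eqfrac => /=; ring.
Qed.

Lemma mulC : commutative mul.
Proof.
move=> x y; have [a [d ->]] := fracP x; have [b [e ->]] := fracP y.
by rewrite !mulE; apply: eqfrac => /=; ring.
Qed.

Lemma mul1 : left_id (frac 1 den1) mul.
Proof.
by move=> x; have [a [d ->]] := fracP x; rewrite mulE; apply: eqfrac => /=; ring.
Qed.

Lemma mulDl : left_distributive mul add.
Proof.
move=> x y z; have [a [d ->]] := fracP x; have [b [e ->]] := fracP y.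
have [c [f ->]] := fracP z.
by rewrite !(addE, mulE); apply: eqfrac => /=; ring.
Qed.

HB.instance Definition _ :=
  GRing.Zmodule_isComPzRing.Build type mulA mulC mul1 mulDl.

Definition inj (a : A) : type := frac a den1.

Lemma inj_zmod : zmod_morphism inj.
Proof.
move=> a b; rewrite /inj -[RHS]/(add _ (opp _)) oppE addE.
by apply: eqfrac => /=; ring.
Qed.

Lemma inj_monoid : monoid_morphism inj.
Proof.
split=> // a b; rewrite /inj -[RHS]/(mul _ _) mulE.
by apply: eqfrac => /=; ring.
Qed.

HB.instance Definition _ := GRing.isZmodMorphism.Build A type inj inj_zmod.
HB.instance Definition _ := GRing.isMonoidMorphism.Build A type inj inj_monoid.

Lemma inj_eq a b : inj a = inj b <-> exists2 w : A, w \in S & w * a = w * b.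
Proof. by rewrite /inj frac_eq /= !mulr1. Qed.

Lemma frac_mul_den a d : frac a d * inj (val d) = inj a.
Proof.
by rewrite -[LHS]/(mul _ _) mulE; apply: eqfrac => /=; ring.
Qed.

Lemma inj_den d : frac 1 d * inj (val d) = 1.
Proof. by rewrite frac_mul_den. Qed.

End Loc.
End Loc.
HB.export Loc.

Section MultiplicativeSubsets.
Variable A : comPzRingType.

Definition powers (s : A) : {pred A} := fun x => `[< exists n, x = s ^+ n >].

Lemma powers_mul_closed s : mulr_closed (powers s).
Proof.
split; first by apply/asboolP; exists 0%N; rewrite expr0.
move=> x y /asboolP[m ->] /asboolP[n ->].
by apply/asboolP; exists (m + n)%N; rewrite exprD.
Qed.

HB.instance Definition _ s :=
  GRing.isMulClosed.Build A (powers s) (powers_mul_closed s).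

Definition regulars : {pred A} := fun x => `[< GRing.lreg x >].

Lemma regulars_mul_closed : mulr_closed regulars.
Proof.
split; first by apply/asboolP; apply: lreg1.
by move=> x y /asboolP rx /asboolP ry; apply/asboolP; apply: lregM.
Qed.

HB.instance Definition _ :=
  GRing.isMulClosed.Build A regulars regulars_mul_closed.

(* A[1/s] and the canonical map from A to it. *)
Definition inv_ring (s : A) : comPzRingType := Loc.type (powers s).
Definition inv_map (s : A) : {rmorphism A -> inv_ring s} :=
  @Loc.inj A (powers s).

(* The total ring of fractions of A and the canonical map from A to it. *)
Definition total_frac : comPzRingType := Loc.type regulars.
Definition total_frac_map : {rmorphism A -> total_frac} := @Loc.inj A regulars.

End MultiplicativeSubsets.

Section Divisors.
Variable A : comPzRingType.

Definition integral_ring : Prop := forall x : A, x = 0 \/ GRing.lreg x.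

Definition depth_ge1 n (a : 'I_n -> A) : Prop :=
  forall x : A, (forall i, a i * x = 0) -> x = 0.

Definition proportional n (a x : 'I_n -> A) : Prop :=
  forall i j, a i * x j = a j * x i.

Definition depth_ge2 n (a : 'I_n -> A) : Prop :=
  depth_ge1 a /\
  forall x : 'I_n -> A, proportional a x ->
    exists y : A, forall j, x j = y * a j.

Definition divides (a b : A) : Prop := exists c : A, b = c * a.

Definition is_gcd (I : finType) (g : A) (a : I -> A) : Prop :=
  (forall i, divides g (a i)) /\
  (forall d : A, (forall i, divides d (a i)) -> divides d g).

Definition strong_gcd (I : finType) (g : A) (a : I -> A) : Prop :=
  [/\ GRing.lreg g, forall i, GRing.lreg (a i)
    & forall x : A, GRing.lreg x -> is_gcd (x * g) (fun i => x * a i)].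

Definition list_div_invertible k (a : 'I_k -> A) : Prop :=
  (forall i, GRing.lreg (a i)) /\
  exists m (b : 'I_m -> A), (forall j, GRing.lreg (b j)) /\
    exists g : A, strong_gcd g (fun p : 'I_k * 'I_m => a p.1 * b p.2).

Definition ideal_gen k (a : 'I_k -> A) : set A :=
  [set x | exists c : 'I_k -> A, x = \sum_i c i * a i]%classic.

(* The property depends only on the ideal generated by the list, so any
   list of regular generators may be used to test it. *)
Definition div_invertible (I : set A) : Prop :=
  exists k (a : 'I_k -> A), I = ideal_gen a /\ list_div_invertible a.

Definition ring_with_divisors : Prop :=
  integral_ring /\
  forall k (a : 'I_k -> A), ideal_gen a <> [set 0]%classic ->
    div_invertible (ideal_gen a).

End Divisors.

(* [mxpoly.integralOver] would require nontrivial rings. *)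
Definition integral_over (A B : comPzRingType) (f : {rmorphism A -> B})
    (y : B) : Prop :=
  exists n (c : 'I_n -> A), y ^+ n + \sum_(i < n) f (c i) * y ^+ i = 0.

Definition integrally_closed (A : comPzRingType) : Prop :=
  integral_ring A /\
  forall y : total_frac A, integral_over (total_frac_map A) y ->
    exists a : A, y = total_frac_map A a.

Arguments integral_ring A : clear implicits.
Arguments ring_with_divisors A : clear implicits.

(* Main.v *)
(** Depth at least 2 makes divisibility local: if [s_i b = a c_i] for all [i],
    then [(c_i)] is proportional to [(s_i)], hence [c_i = y s_i] and [b = y a].
    Strong gcds and integral closedness are expressed by divisibilities, hence
    are local as well.  For divisorial invertibility, the lists found over the
    A[1/s_i] are normalised so that they all give the same strong gcd [u_0], an
    element of the list to be inverted; their concatenation then works over A.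
    Throughout, A[1/s] is either trivial or a localisation at a regular [s]. *)

Require Import Defs.
From mathcomp Require Import all_boot all_order all_algebra.
From mathcomp Require Import ring boolp classical_sets.

Import GRing.Theory.
Local Open Scope ring_scope.

(** * Divisibility, regular elements and trivial rings *)

Lemma divides_mull (A : comPzRingType) (a b x : A) :
  divides a b -> divides a (x * b).
Proof. by case=> c ->; exists (x * c); rewrite mulrA. Qed.

Lemma divides_sum (A : comPzRingType) (I : finType) (a : A) (b : I -> A) :
  (forall i, divides a (b i)) -> divides a (\sum_i b i).
Proof.
move=> /choice[c hc]; exists (\sum_i c i).
by rewrite mulr_suml; apply: eq_bigr.
Qed.

Lemma divides_pmul2l (A : comPzRingType) (x a b : A) :
  GRing.lreg x -> divides (x * a) (x * b) <-> divides a b.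
Proof.
move=> rx; split=> -[c hc]; exists c; first by apply: rx; rewrite hc; ring.
by rewrite hc; ring.
Qed.

Lemma divides_rmorph (A B : comPzRingType) (f : {rmorphism A -> B}) (a b : A) :
  divides a b -> divides (f a) (f b).
Proof. by case=> c ->; exists (f c); rewrite rmorphM. Qed.

Lemma divides_unitl (A : comPzRingType) (t u a b : A) :
  t * u = 1 -> divides (a * u) b <-> divides a b.
Proof.
move=> tu; split=> -[c ->]; first by exists (c * u); ring.
by exists (c * t); transitivity (c * a * (t * u)); [rewrite tu mulr1 | ring].
Qed.

Lemma divides_unitr (A : comPzRingType) (t u a b : A) :
  t * u = 1 -> divides a (b * u) <-> divides a b.
Proof.
move=> tu; split=> -[c hc]; last by exists (c * u); rewrite hc; ring.
by exists (t * c); rewrite -mulrA -hc -[LHS]mulr1 -tu; ring.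
Qed.

Lemma lreg_unit (A : comPzRingType) (t u : A) : t * u = 1 -> GRing.lreg u.
Proof. by move=> tu x y e; rewrite -[x]mul1r -[y]mul1r -tu -!mulrA e. Qed.

Lemma lreg_factorl (A : comPzRingType) (x y : A) :
  GRing.lreg (x * y) -> GRing.lreg x.
Proof. by move=> r a b e; apply: r; rewrite mulrAC e mulrAC. Qed.

Lemma trivial_ring_eq (A : comPzRingType) :
  1 = 0 :> A -> forall x y : A, x = y.
Proof. by move=> h x y; rewrite -[x]mul1r -[y]mul1r h !mul0r. Qed.

Lemma trivial_strong_gcd (A : comPzRingType) (I : finType) (g : A) (a : I -> A) :
  1 = 0 :> A -> strong_gcd g a.
Proof.
move=> /trivial_ring_eq e.
split=> *; [by move=> ? ? _; apply: e | by move=> ? ? _; apply: e |].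
by split=> *; exists 1; apply: e.
Qed.

Lemma trivial_list_div_invertible (A : comPzRingType) k (a : 'I_k -> A) :
  1 = 0 :> A -> list_div_invertible a.
Proof.
move=> e; split; first by move=> i x y _; apply: trivial_ring_eq.
exists 0%N, (fun=> 0); split; first by move=> i x y _; apply: trivial_ring_eq.
by exists 0; apply: trivial_strong_gcd.
Qed.

(** * Finitely generated ideals and divisorial invertibility *)

Section IdealGen.
Variable A : comPzRingType.

Lemma ideal_gen_mem k (a : 'I_k -> A) j : ideal_gen a (a j).
Proof.
exists (fun i => (i == j)%:R); rewrite (bigD1 j) //= eqxx mul1r big1 ?addr0 //.
by move=> i /negPf->; rewrite mul0r.
Qed.

Lemma ideal_gen_sub k l (a : 'I_k -> A) (b : 'I_l -> A) :
  (forall j, ideal_gen b (a j)) -> (ideal_gen a `<=` ideal_gen b)%classic.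
Proof.
move=> /choice[c hc] x [d ->]; exists (fun i => \sum_j d j * c j i).
under [RHS]eq_bigr do rewrite mulr_suml.
rewrite exchange_big; apply: eq_bigr => j _ /=.
by rewrite hc mulr_sumr; apply: eq_bigr => i _; rewrite mulrA.
Qed.

Lemma eq_ideal_gen k l (a : 'I_k -> A) (b : 'I_l -> A) :
  (forall j, ideal_gen b (a j)) -> (forall j, ideal_gen a (b j)) ->
  ideal_gen a = ideal_gen b.
Proof. by move=> ab ba; apply/seteqP; split; apply: ideal_gen_sub. Qed.

Lemma ideal_gen_rmorph_mem (B : comPzRingType) (f : {rmorphism A -> B})
    k (a : 'I_k -> A) x :
  ideal_gen a x -> ideal_gen (fun j => f (a j)) (f x).
Proof.
case=> c ->; exists (fun i => f (c i)); rewrite rmorph_sum.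
by apply: eq_bigr => i _; rewrite rmorphM.
Qed.

Lemma ideal_gen_scale_unit k (t u : A) (a : 'I_k -> A) :
  t * u = 1 -> ideal_gen (fun j => a j * u) = ideal_gen a.
Proof.
move=> tu; apply/seteqP; split=> x [c ->].
  by exists (fun j => c j * u); apply: eq_bigr => i _; ring.
exists (fun j => c j * t); apply: eq_bigr => i _.
by rewrite -[LHS]mulr1 -tu; ring.
Qed.

Lemma ideal_gen_divides k (a : 'I_k -> A) d x y :
  (forall j, divides d (x * a j)) -> ideal_gen a y -> divides d (x * y).
Proof.
move=> h [c ->]; rewrite mulr_sumr; apply: divides_sum => i.
by rewrite mulrCA; apply: divides_mull.
Qed.

(** The same [b] and [g] serve for both lists: an element dividing every [x * b l * v i] divides
    [x * b l * y] for all [y] in the ideal, so both families of products have the same common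
    divisors. *)
Lemma list_div_invertible_gen k l (u : 'I_k -> A) (v : 'I_l -> A) :
  (forall j, GRing.lreg (u j)) -> ideal_gen u = ideal_gen v ->
  list_div_invertible v -> list_div_invertible u.
Proof.
move=> ru e [rv [m [b [rb [g [rg _ hg]]]]]]; split=> //.
exists m, b; split=> //; exists g; split=> //.
  by move=> p; apply: lregM.
move=> x rx; have [gv vg] := hg x rx; split=> [[j l']|d dh] /=.
  rewrite (mulrC (u j)) mulrA; apply: (@ideal_gen_divides _ v).
    by move=> i; have := gv (i, l'); rewrite /= (mulrC (v i)) mulrA.
  by rewrite -e; apply: ideal_gen_mem.
apply: vg => -[j l'] /=.
rewrite (mulrC (v j)) mulrA; apply: (@ideal_gen_divides _ u).
  by move=> i; have := dh (i, l'); rewrite /= (mulrC (u i)) mulrA.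
by rewrite e; apply: ideal_gen_mem.
Qed.

(** Although [div_invertible] only asks for some generating list, independence of the generators
    lets any regular list be tested. *)
Lemma div_invertibleP k (u : 'I_k -> A) : (forall j, GRing.lreg (u j)) ->
  div_invertible (ideal_gen u) <-> list_div_invertible u.
Proof.
move=> ru; split; last by move=> h; exists k, u.
by case=> l [v [e /list_div_invertible_gen]]; apply.
Qed.

(** The family of products is empty, so even [0] is a common divisor and must divide the gcd [g];
    hence [g = 0] is regular. *)
Lemma list_div_invertible0 (u : 'I_0 -> A) :
  list_div_invertible u -> 1 = 0 :> A.
Proof.
case=> _ [m [b [_ [g [rg _ /(_ 1 (@lreg1 _))[_ /(_ 0)]]]]]].
case; first by case; case.
by move=> c; rewrite mulr0 mul1r => g0; apply: rg; rewrite g0 !mul0r.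
Qed.

(** Discarding the zero generators suffices, since the others are regular in an integral ring. The
    resulting list may be empty. *)
Lemma ideal_gen_regular k (u : 'I_k -> A) : integral_ring A ->
  exists l (v : 'I_l -> A),
    (forall j, GRing.lreg (v j)) /\ ideal_gen u = ideal_gen v.
Proof.
move=> hA; pose V := [seq x <- codom u | x != 0].
exists (size V), (tnth (in_tuple V)); split=> [j|].
  have := mem_tnth j (in_tuple V); rewrite mem_filter => /andP[/eqP nz _].
  by case: (hA (tnth (in_tuple V) j)).
apply: eq_ideal_gen => j.
  have [uj0|nz] := eqVneq (u j) 0.
    by exists (fun=> 0); rewrite uj0 big1 // => i _; rewrite mul0r.
  have /tnthP[i ->] : u j \in in_tuple V by rewrite mem_filter nz codom_f.
  exact: ideal_gen_mem.
have := mem_tnth j (in_tuple V); rewrite mem_filter => /andP[_ /codomP[i ->]].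
exact: ideal_gen_mem.
Qed.

End IdealGen.

Lemma ideal_gen_rmorph (A B : comPzRingType) (f : {rmorphism A -> B})
    k l (a : 'I_k -> A) (b : 'I_l -> A) :
  ideal_gen a = ideal_gen b ->
  ideal_gen (fun j => f (a j)) = ideal_gen (fun j => f (b j)).
Proof.
move=> e; apply: eq_ideal_gen => j; apply: ideal_gen_rmorph_mem.
  by rewrite -e; apply: ideal_gen_mem.
by rewrite e; apply: ideal_gen_mem.
Qed.

(** * Localisation at the powers of a single element *)

Lemma common_bound (I : finType) (N : I -> nat) :
  exists M, forall i, (N i <= M)%N.
Proof. by exists (\max_i N i)%N => i; apply: leq_bigmax. Qed.

Section InvRing.
Variables (A : comPzRingType) (s : A).
Local Notation f := (inv_map s).

Lemma inv_map_eq a b : f a = f b <-> exists N, s ^+ N * a = s ^+ N * b.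
Proof.
split=> [/Loc.inj_eq[w /asboolP[N ->]]|[N h]]; first by exists N.
by apply/Loc.inj_eq; exists (s ^+ N) => //; apply/asboolP; exists N.
Qed.

Lemma inv_map_unit N : exists t, t * f (s ^+ N) = 1.
Proof.
have h : s ^+ N \in powers s by apply/asboolP; exists N.
exists (Loc.frac 1 (exist (fun d => d \in powers s) _ h)).
exact: (@Loc.inj_den A (powers s)).
Qed.

Lemma inv_ring_fraction x : exists N a, x * f (s ^+ N) = f a.
Proof.
have [a [[d dP] ->]] := @Loc.fracP A (powers s) x.
have /asboolP[N e] := dP; exists N, a.
have := @Loc.frac_mul_den A (powers s) a (exist (fun d => d \in powers s) d dP).
by rewrite /= {2}e.
Qed.

Lemma inv_ring_fractions (I : finType) (x : I -> inv_ring s) :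
  exists N (a : I -> A), forall i, x i * f (s ^+ N) = f (a i).
Proof.
have /choice[N /choice[a h]] := fun i => inv_ring_fraction (x i).
have [M leM] := common_bound _ N.
exists M, (fun i => a i * s ^+ (M - N i)) => i.
by rewrite rmorphM -h -mulrA -rmorphM -exprD subnKC.
Qed.

Lemma divides_inv_map a b :
  divides (f a) (f b) <-> exists N, divides a (s ^+ N * b).
Proof.
split=> [[x e]|[N /(divides_rmorph _ _ f)]]; last first.
  have [t tu] := inv_map_unit N.
  by rewrite rmorphM mulrC => /(divides_unitr _ _ _ _ _ tu).
have [N [c hc]] := inv_ring_fraction x.
have /inv_map_eq[M h] : f (s ^+ N * b) = f (c * a).
  by rewrite !rmorphM -hc e; ring.
by exists (M + N)%N, (s ^+ M * c); rewrite exprD -!mulrA h.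
Qed.

Lemma divides_inv_map_all (I : finType) (a b : I -> A) :
  (forall i, divides (f (a i)) (f (b i))) ->
  exists N, forall i, divides (a i) (s ^+ N * b i).
Proof.
move=> h; have /choice[N hN] := fun i => (divides_inv_map (a i) (b i)).1 (h i).
have [M leM] := common_bound _ N; exists M => i.
by rewrite -(subnK (leM i)) exprD -mulrA; apply: divides_mull.
Qed.

Lemma lreg_inv_map a : GRing.lreg a -> GRing.lreg (f a).
Proof.
move=> ra x y e.
(* Indexing by [bool] puts [x] and [y] over a common denominator. *)
have [N [c hc]] := inv_ring_fractions _ (fun b : bool => if b then x else y).
have /inv_map_eq[M h] : f (a * c true) = f (a * c false).
  by rewrite !rmorphM -!hc /= !mulrA e.
have [t tu] := inv_map_unit N.
have k : f (c true) = f (c false).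
  by apply/inv_map_eq; exists M; apply: ra; rewrite mulrCA h mulrCA.
by apply: (lreg_unit _ _ _ tu); have := k; rewrite -!hc /= !(mulrC (f _)).
Qed.

Lemma inv_map_inj : GRing.lreg s -> injective f.
Proof. by move=> rs a b /inv_map_eq[N]; apply: lregX. Qed.

Lemma lreg_of_inv_map a : GRing.lreg s -> GRing.lreg (f a) -> GRing.lreg a.
Proof.
by move=> rs ra x y e; apply: inv_map_inj => //; apply: ra; rewrite -!rmorphM e.
Qed.

Hypothesis hA : integral_ring A.

Lemma inv_ring_trivial_or_regular : 1 = 0 :> inv_ring s \/ GRing.lreg s.
Proof.
case: (hA s) => [s0|]; [left | by right].
rewrite -(rmorph1 f) -(rmorph0 f); apply/inv_map_eq; exists 1%N.
by rewrite s0 expr1 !mul0r.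
Qed.

Lemma integral_inv_ring : integral_ring (inv_ring s).
Proof.
move=> x; have [N [a e]] := inv_ring_fraction x.
case: (hA a) => [a0|ra]; [left | right].
  have [t tu] := inv_map_unit N; apply: (lreg_unit _ _ _ tu).
  by rewrite mulr0 mulrC e a0 rmorph0.
by apply: (@lreg_factorl _ x (f (s ^+ N))); rewrite e; apply: lreg_inv_map.
Qed.

(** Clearing denominators in a divisibility over A[1/s] costs a power of [s]. A strong gcd tolerates
    this: the power is absorbed into the regular multiplier, which a plain gcd would not allow. *)
Lemma strong_gcd_inv_map (I : finType) g (a : I -> A) :
  strong_gcd g a -> strong_gcd (f g) (fun i => f (a i)).
Proof.
case=> rg ra hg.
have [e|rs] := inv_ring_trivial_or_regular; first exact: trivial_strong_gcd.
split=> [|i|x rx]; [exact: lreg_inv_map | exact: lreg_inv_map |].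
split=> [i|d dh].
  apply/divides_pmul2l => //; apply: divides_rmorph.
  by have [/(_ i)] := hg _ (@lreg1 _); rewrite !mul1r.
have [N [x' hx]] := inv_ring_fraction x; have [t tu] := inv_map_unit N.
have [M [d' hd]] := inv_ring_fraction d; have [t' tu'] := inv_map_unit M.
have rx' : GRing.lreg x'.
  apply: lreg_of_inv_map; rewrite // -hx.
  by apply: lregM => //; apply: lreg_unit tu.
have /divides_inv_map_all[K hK] i : divides (f d') (f (x' * a i)).
  rewrite -hd; apply/(divides_unitl _ _ _ _ _ tu').
  by rewrite rmorphM -hx mulrAC; apply/(divides_unitr _ _ _ _ _ tu).
apply/(divides_unitl _ _ _ _ _ tu'); rewrite hd.
apply/(divides_unitr _ _ _ _ _ tu); rewrite mulrAC hx -rmorphM.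
apply/divides_inv_map; exists K; rewrite mulrA.
apply: (hg _ _).2; first by apply: lregM => //; apply: lregX.
by move=> i; rewrite -mulrA.
Qed.

Lemma list_div_invertible_inv_map k (u : 'I_k -> A) :
  list_div_invertible u -> list_div_invertible (fun j => f (u j)).
Proof.
case=> ru [m [b [rb [g hg]]]]; split=> [i|]; first exact: lreg_inv_map.
exists m, (fun j => f (b j)); split=> [i|]; first exact: lreg_inv_map.
exists (f g); have := strong_gcd_inv_map _ _ _ hg.
by congr strong_gcd; apply/funext => p; rewrite rmorphM.
Qed.

(* If [g] is a strong gcd of the [u j * b l] over A[1/s], then [B] consists of
   the [u j0 * b l / g], multiplied by a power of [s] large enough for all the
   divisibilities by [u j0] to hold in A: the new gcd [u j0] does not depend on
   [s], so that these lists can be concatenated. *)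
Lemma local_divisorial_inverse k (u : 'I_k -> A) (j0 : 'I_k) :
  (forall j, GRing.lreg (u j)) -> list_div_invertible (fun j => f (u j)) ->
  exists B : seq A,
    (forall b, b \in B -> GRing.lreg b /\ forall j, divides (u j0) (u j * b)) /\
    (forall x d, GRing.lreg x ->
       (forall j b, b \in B -> divides d (x * (u j * b))) ->
       divides (f d) (f (x * u j0))).
Proof.
move=> ru [_ [m [b [rb [g [rg _ hg]]]]]].
have [e|rs] := inv_ring_trivial_or_regular.
  by exists [::]; split=> // x d _ _; exists 1; apply: trivial_ring_eq.
have gu p : divides g (f (u p.1) * b p.2).
  by have [/(_ p)] := hg _ (@lreg1 _); rewrite !mul1r.
(* Here [c l] is the quotient of [f (u j0) * b l] by [g]. *)
have /choice[c hc] l : exists c, f (u j0) * b l = c * g by exact: gu (j0, l).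
have rc l : GRing.lreg (c l).
  apply: (@lreg_factorl _ _ g); rewrite -hc.
  by apply: lregM => //; apply: lreg_inv_map.
have uc p : divides (f (u j0)) (f (u p.1) * c p.2).
  have [e he] := gu p; exists e; apply: rg.
  transitivity (f (u p.1) * (c p.2 * g)); first by ring.
  by rewrite -hc mulrCA he; ring.
have [N [c' hc']] := inv_ring_fractions _ c; have [t tu] := inv_map_unit N.
have /divides_inv_map_all[K hK] (p : 'I_k * 'I_m) :
    divides (f (u j0)) (f (u p.1 * c' p.2)).
  by rewrite rmorphM -hc' mulrA; apply/(divides_unitr _ _ _ _ _ tu).
exists (codom (fun l => s ^+ K * c' l)); split=> [_ /codomP[l ->]|x d rx hd].
  split=> [|j]; last by rewrite mulrCA; apply: hK (j, l).
  apply: lregM; first exact: lregX.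
  apply: lreg_of_inv_map; rewrite // -hc'.
  by apply: lregM => //; apply: lreg_unit tu.
(* Multiplied by [g], the target becomes the gcd given by the multiplier [f x * f (u j0)], and each
   member of that family equals [g * (f x * (f (u j) * c l))]. *)
rewrite rmorphM; apply/(divides_pmul2l _ g) => //; rewrite [g * (_ * _)]mulrC.
apply: (hg _ _).2 => [|[j l] /=]; first by apply: lregM; apply: lreg_inv_map.
have [t' tu'] := inv_map_unit K.
have := divides_rmorph _ _ f _ _ (hd j _ (codom_f _ l)).
rewrite !rmorphM -hc' => h.
have {}h : divides (f d) (f x * (f (u j) * c l)).
  apply/(divides_unitr _ _ _ _ _ tu')/(divides_unitr _ _ _ _ _ tu).
  by move: h; congr divides; rewrite /=; ring.
have -> : f x * f (u j0) * (f (u j) * b l) = g * (f x * (f (u j) * c l)).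
  by transitivity (f x * f (u j) * (f (u j0) * b l)); [ring | rewrite hc; ring].
by apply/divides_pmul2l.
Qed.

Lemma ring_with_divisors_inv_ring :
  ring_with_divisors A -> ring_with_divisors (inv_ring s).
Proof.
case=> _ hd; split=> [|k a nz]; first exact: integral_inv_ring.
have [N [a' e]] := inv_ring_fractions _ a; have [t tu] := inv_map_unit N.
have ea : ideal_gen a = ideal_gen (fun j => f (a' j)).
  rewrite -(ideal_gen_scale_unit _ _ _ _ a tu); congr ideal_gen; exact/funext.
(* If the numerators generate the zero ideal of [A], then [a] generates the zero ideal of A[1/s],
   against [nz]. *)
case: (hd _ a') => [a0|l [v [ev hv]]].
  case: nz; rewrite ea; apply/seteqP; split=> [x [c ->]|x ->] /=; last first.
    by exists (fun=> 0); rewrite big1 // => i _; rewrite mul0r.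
  rewrite big1 // => i _.
  have := ideal_gen_mem _ _ a' i; rewrite a0 /= => ->.
  by rewrite rmorph0 mulr0.
exists l, (fun j => f (v j)); split; last exact: list_div_invertible_inv_map.
by rewrite ea; apply: ideal_gen_rmorph.
Qed.

End InvRing.

(** * Integral closedness *)

(* An equation of integral dependence of [a / d], cleared of denominators. *)
Definition integral_eq (A : comPzRingType) n (c : 'I_n -> A) (a d : A) : Prop :=
  a ^+ n + \sum_(i < n) c i * a ^+ i * d ^+ (n - i) = 0.

(** The cleared equation is homogeneous of degree [n] in numerator and denominator. *)
Lemma homogeneous_scale (A : comPzRingType) n (c : 'I_n -> A) (t y d : A) :
  (t * y) ^+ n + \sum_(i < n) c i * (t * y) ^+ i * (t * d) ^+ (n - i) =
  t ^+ n * (y ^+ n + \sum_(i < n) c i * y ^+ i * d ^+ (n - i)).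
Proof.
rewrite mulrDr exprMn mulr_sumr; congr (_ + _); apply: eq_bigr => i _.
have e : t ^+ n = t ^+ i * t ^+ (n - i) by rewrite -exprD subnKC // ltnW.
by rewrite !exprMn e; ring.
Qed.

Lemma integral_eq_rmorph (A B : comPzRingType) (f : {rmorphism A -> B})
    n (c : 'I_n -> A) a d :
  f (a ^+ n + \sum_(i < n) c i * a ^+ i * d ^+ (n - i)) =
  f a ^+ n + \sum_(i < n) f (c i) * f a ^+ i * f d ^+ (n - i).
Proof.
rewrite rmorphD rmorph_sum rmorphXn; congr (_ + _).
by apply: eq_bigr => i _; rewrite !rmorphM !rmorphXn.
Qed.

(** Writing an element of the total ring of fractions as [a / d] turns integral closedness into a
    divisibility inside [A], a form that can be compared with the localisations. *)
Lemma integrally_closedP (A : comPzRingType) :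
  integrally_closed A <->
  integral_ring A /\ forall n (c : 'I_n -> A) a d,
    GRing.lreg d -> integral_eq A n c a d -> divides d a.
Proof.
pose F := total_frac_map A.
have F_inj : injective F.
  by move=> x y /Loc.inj_eq[w /asboolP rw]; apply: rw.
have fracE a d (hd : d \in @regulars A) :
    Loc.frac a (exist (fun d => d \in @regulars A) d hd) * F d = F a
    :> total_frac A.
  exact: (@Loc.frac_mul_den A (@regulars A)).
have Funit d : d \in @regulars A -> exists t, t * F d = 1.
  move=> hd; exists (Loc.frac 1 (exist (fun d => d \in @regulars A) d hd)).
  exact: (@Loc.inj_den A (@regulars A)).
have integralE n (c : 'I_n -> A) (y : total_frac A) a d :
    d \in @regulars A -> y * F d = F a ->
    y ^+ n + \sum_(i < n) F (c i) * y ^+ i = 0 <-> integral_eq A n c a d.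
  move=> hd e; have [t tu] := Funit d hd.
  have E : F (a ^+ n + \sum_(i < n) c i * a ^+ i * d ^+ (n - i)) =
           F d ^+ n * (y ^+ n + \sum_(i < n) F (c i) * y ^+ i).
    (* Scaling the pair [(y, 1)] by [F d] gives [(F a, F d)]. *)
    have := homogeneous_scale _ n (fun i => F (c i)) (F d) y 1.
    rewrite integral_eq_rmorph -e mulr1 (mulrC y) => ->.
    by congr (_ * (_ + _)); apply: eq_bigr => i _; rewrite expr1n mulr1.
  split=> [h|h].
    by apply: F_inj; rewrite E h mulr0 rmorph0.
  have rF : GRing.lreg (F d ^+ n) by apply/lregX/lreg_unit/tu.
  apply: rF.
  by rewrite -E [X in F X]h mulr0 rmorph0.
split=> -[hA h]; split=> //.
  move=> n c a d rd hc.
  have hd : d \in @regulars A by apply/asboolP.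
  have e := fracE a d hd.
  have [|b hb] := h (Loc.frac a (exist (fun d => d \in @regulars A) d hd)).
    by exists n, c; apply/(integralE _ _ _ _ _ hd e).
  by exists b; apply: F_inj; rewrite rmorphM -e hb.
move=> y [n [c hc]].
have [a [[d hd] ey]] := @Loc.fracP A (@regulars A) y.
have e : y * F d = F a by rewrite ey fracE.
have rd : GRing.lreg d by apply/asboolP.
have [b hb] := h n c a d rd ((integralE _ _ _ _ _ hd e).1 hc).
have [t tu] := Funit d hd.
exists b; apply: (lreg_unit _ _ _ tu); rewrite mulrC e hb rmorphM; exact: mulrC.
Qed.

Lemma integrally_closed_inv_ring (A : comPzRingType) (s : A) :
  integrally_closed A -> integrally_closed (inv_ring s).
Proof.
move=> /integrally_closedP[hA h]; apply/integrally_closedP.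
split=> [|n c a d rd hc]; first exact: integral_inv_ring.
have [e|rs] := inv_ring_trivial_or_regular _ s hA.
  by exists 1; apply: trivial_ring_eq.
have [N [c' hc']] := inv_ring_fractions _ s _ c.
have [M [a' ha]] := inv_ring_fraction _ s a.
have [K [d' hd]] := inv_ring_fraction _ s d.
have [t tu] := inv_map_unit _ s N.
have [tM tuM] := inv_map_unit _ s M.
have [tK tuK] := inv_map_unit _ s K.
have rd' : GRing.lreg d'.
  apply: lreg_of_inv_map rs _; rewrite -hd.
  by apply: lregM => //; apply: lreg_unit tuK.
pose f := inv_map s.
(* Up to the map [f], [a1 / d1] is [s ^+ N] times [a / d]: the factor [s ^+ (K + M)] clears both
   denominators, and the extra [s ^+ N] serves to clear those of the coefficients. *)
pose a1 := s ^+ N * (s ^+ K * a'); pose d1 := s ^+ M * d'.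
have ea : f (s ^+ N) * f (s ^+ (K + M)) * a = f a1.
  by rewrite /a1 !rmorphM -ha exprD !rmorphM; ring.
have ed : f (s ^+ (K + M)) * d = f d1.
  by rewrite /d1 !rmorphM -hd exprD !rmorphM; ring.
have rd1 : GRing.lreg d1 by apply: lregM => //; apply: lregX.
(* Scaling a root by [s ^+ N] multiplies the [i]-th coefficient by the power [n - i] of [s ^+ N].
   One factor turns [c i] into [c' i]; as [i < n], the predecessor counts the remaining ones. *)
pose c1 i := c' i * s ^+ (N * (n - i).-1).
have : divides d1 a1.
  apply: (h n c1 _ _ rd1).
  apply: (inv_map_inj _ _ rs); rewrite rmorph0 integral_eq_rmorph.
  transitivity ((f (s ^+ N) * f (s ^+ (K + M))) ^+ n *
    (a ^+ n + \sum_(i < n) c i * a ^+ i * d ^+ (n - i))); last first.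
    by rewrite [X in _ * X]hc mulr0.
  rewrite -homogeneous_scale -/f ea; congr (_ + _).
  apply: eq_bigr => i _.
  rewrite -[_ * _ * d]mulrA ed exprMn /c1 rmorphM -hc' -/f.
  have -> : f (s ^+ (N * (n - i).-1)) = f (s ^+ N) ^+ (n - i).-1.
    by rewrite exprM rmorphXn.
  have e : f (s ^+ N) ^+ (n - i) = f (s ^+ N) * f (s ^+ N) ^+ (n - i).-1.
    by rewrite -exprS prednK // subn_gt0.
  by rewrite e; ring.
move=> /(divides_rmorph _ _ f); rewrite -ea -ed => hdiv.
have rsN m : GRing.lreg (f (s ^+ m)).
  by have [t' tu'] := inv_map_unit _ s m; apply: lreg_unit tu'.
move: hdiv; rewrite -mulrA mulrCA => /(divides_pmul2l _ _ _ _ (rsN _)).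
by rewrite mulrC => /(divides_unitr _ _ _ _ _ tu).
Qed.

(** * Local-global principles for a sequence of depth at least 2 *)

Section DepthTwo.
Variables (A : comPzRingType) (n : nat) (s : 'I_n -> A).
Hypotheses (hA : integral_ring A) (hs : depth_ge2 s).

Lemma depth_ge2_divides a b : (forall i, divides a (s i * b)) -> divides a b.
Proof.
case: hs => d1 d2 /choice[c hc].
(* Proportionality of [c] to [s] is obtained by cancelling [a], which must be regular. If [a = 0],
   every [s i * b] vanishes and depth at least 1 gives [b = 0]. *)
have [a0|ra] := hA a.
  by exists 0; rewrite mul0r; apply: d1 => i; rewrite hc a0 mulr0.
have [|y hy] := d2 c.
  move=> i j; apply: ra.
  transitivity (s i * (c j * a)); first by ring.
  by rewrite -hc mulrCA hc; ring.
exists y; apply/eqP; rewrite -subr_eq0; apply/eqP/d1 => i.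
by rewrite mulrBr hc hy; ring.
Qed.

(* Induction on the sum of the exponents: [s j * b] needs one factor [s j] less. *)
Lemma depth_ge2_divides_powers a b (N : 'I_n -> nat) :
  (forall i, divides a (s i ^+ N i * b)) -> divides a b.
Proof.
have [m] := ubnP (\sum_i N i)%N; elim: m => // m IH in b N *.
rewrite ltnS => lem h.
have [/existsP[i /eqP Ni]|/existsPn N0] := boolP [exists i, N i == 0%N].
  by have := h i; rewrite Ni expr0 mul1r.
apply: depth_ge2_divides => j.
(* Only the exponent at [j] drops: there [s j] supplies the missing factor, elsewhere it is a
   harmless multiplier. *)
apply: (IH _ (fun i => N i - (i == j))%N) => [|i].
  apply: leq_trans lem; rewrite (bigD1 j) // [leqRHS](bigD1 j) //= eqxx.
  rewrite -addSn subn1 prednK ?lt0n ?N0 // leq_add2l leq_sum // => i _.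
  exact: leq_subr.
have [->|_] := eqVneq i j; last by rewrite subn0 mulrCA; apply: divides_mull.
by rewrite mulrA -exprSr subn1 prednK ?lt0n ?N0.
Qed.

Lemma divides_local a b :
  divides a b <-> forall i, divides (inv_map (s i) a) (inv_map (s i) b).
Proof.
split=> [h i|h]; first exact: divides_rmorph.
have /choice[N hN] := fun i => (divides_inv_map _ _ _ _).1 (h i).
exact: depth_ge2_divides_powers hN.
Qed.

(** A regular [x] stays regular in each localisation, so both halves of the gcd condition are
    divisibilities that can be checked locally. *)
Lemma strong_gcd_local (I : finType) (g : A) (a : I -> A) :
  GRing.lreg g -> (forall j, GRing.lreg (a j)) ->
  strong_gcd g a <->
  forall i, strong_gcd (inv_map (s i) g) (fun j => inv_map (s i) (a j)).
Proof.
move=> rg ra; split=> [h i|h]; first exact: strong_gcd_inv_map.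
split=> // x rx; split=> [j|d hd]; apply/divides_local => i;
  have [_ _ /(_ _ (lreg_inv_map _ _ _ rx))[gd dg]] := h i; rewrite rmorphM.
  by rewrite rmorphM.
by apply: dg => j; rewrite -rmorphM; apply: divides_rmorph.
Qed.

Lemma list_div_invertible_local k (u : 'I_k -> A) :
  (forall j, GRing.lreg (u j)) ->
  (forall i, list_div_invertible (fun j => inv_map (s i) (u j))) ->
  list_div_invertible u.
Proof.
(* For an empty list every localisation is trivial, so [0] divides [1] locally, hence in [A]. *)
case: k u => [|k] u ru h.
  apply: trivial_list_div_invertible.
  have /divides_local[c ->] i : divides (inv_map (s i) 0) (inv_map (s i) 1).
    by exists 1; apply/trivial_ring_eq/list_div_invertible0/h.
  by rewrite mulr0.
have /choice[B /all_and2[hB1 hB2]] :=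
  fun i => local_divisorial_inverse _ _ hA _ _ ord0 ru (h i).
pose V := flatten [seq B i | i <- enum 'I_n].
have VP b : b \in V -> exists i, b \in B i.
  by move=> /flattenP[S /mapP[i _ ->] bS]; exists i.
have hV j : exists i, tnth (in_tuple V) j \in B i by apply/VP/mem_tnth.
split=> //; exists (size V), (tnth (in_tuple V)).
have rV j : GRing.lreg (tnth (in_tuple V) j).
  by have [i /hB1[]] := hV j.
(* The first entry is the gcd prescribed in every localisation. To see locally at [i] that a common
   divisor divides [x * u ord0], the portion [B i] of [V] is enough. *)
split=> //; exists (u ord0); split=> // [p|x rx]; first exact: lregM.
split=> [[j l]|d hd] /=.
  by apply/divides_pmul2l => //; have [i /hB1[_]] := hV l; apply.
apply/divides_local => i; apply: hB2 => // j b bB.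
have /tnthP[l ->] : b \in in_tuple V.
  by apply/flattenP; exists (B i) => //; apply: map_f; rewrite mem_enum.
exact: hd (j, l).
Qed.

Lemma div_invertible_local k (u : 'I_k -> A) :
  (forall j, GRing.lreg (u j)) ->
  div_invertible (ideal_gen u) <->
  forall i, div_invertible (ideal_gen (fun j => inv_map (s i) (u j))).
Proof.
move=> ru.
have ru' i j : GRing.lreg (inv_map (s i) (u j)) by apply: lreg_inv_map.
split=> [/div_invertibleP h i|h]; apply/div_invertibleP => //.
  by apply: list_div_invertible_inv_map => //; apply: h.
apply: list_div_invertible_local => // i; exact/div_invertibleP/h.
Qed.

Lemma integrally_closed_local :
  integrally_closed A <-> forall i, integrally_closed (inv_ring (s i)).
Proof.
split=> [h i|h]; first exact: integrally_closed_inv_ring.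
apply/integrally_closedP; split=> // m c a d rd e.
apply/divides_local => i; have /integrally_closedP[_ hi] := h i.
apply: (hi m (fun j => inv_map (s i) (c j))); first exact: lreg_inv_map.
by rewrite /integral_eq -integral_eq_rmorph e rmorph0.
Qed.

Lemma ring_with_divisors_local :
  ring_with_divisors A <-> forall i, ring_with_divisors (inv_ring (s i)).
Proof.
split=> [h i|h]; first exact: ring_with_divisors_inv_ring.
split=> // k u nz; have [[|l] [v [rv e]]] := ideal_gen_regular _ _ u hA.
  (* An empty list of regular generators means the zero ideal, which is excluded. *)
  case: nz; rewrite e; apply/seteqP; split=> [x [c ->]|x ->] /=.
    by rewrite big_ord0.
  by exists (fun=> 0); rewrite big_ord0.
rewrite e; apply/div_invertible_local => // i; have [_ hi] := h i.
(* In a trivial localisation the extended ideal is zero and [hi] does not apply, so invertibility is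
   given directly. Otherwise the image of the regular [v ord0] is nonzero. *)
have [e1|ne1] := pselect (1 = 0 :> inv_ring (s i)).
  exists l.+1, (fun j => inv_map (s i) (v j)); split=> //.
  exact: trivial_list_div_invertible.
apply: hi => v0; apply/ne1/(lreg_inv_map _ (s i) _ (rv ord0)).
have := ideal_gen_mem _ _ (fun j => inv_map (s i) (v j)) ord0.
by rewrite v0 /= => ->; rewrite !mul0r.
Qed.

End DepthTwo.

Theorem mainTheorem8 (A : comPzRingType) (n : nat) (s : 'I_n -> A)
    (hA : integral_ring A) (hs : depth_ge2 s) :
  ((forall a b : A,
      divides a b <->
      forall i, divides (inv_map (s i) a) (inv_map (s i) b)) /\
   (forall (a : A) (k : nat) (u : 'I_k -> A),
      GRing.lreg a -> (forall j, GRing.lreg (u j)) ->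
      (strong_gcd a u <->
       forall i, strong_gcd (inv_map (s i) a) (fun j => inv_map (s i) (u j)))) /\
   (forall (k : nat) (u : 'I_k -> A),
      (forall j, GRing.lreg (u j)) ->
      (div_invertible (ideal_gen u) <->
       forall i, div_invertible (ideal_gen (fun j => inv_map (s i) (u j)))))) /\
  (integrally_closed A <-> forall i, integrally_closed (inv_ring (s i))) /\
  (ring_with_divisors A <-> forall i, ring_with_divisors (inv_ring (s i))).
Proof.
split; [split; [|split] | split].
- exact: divides_local.
- by move=> a k u; apply: strong_gcd_local.
- by move=> k u; apply: div_invertible_local.
- exact: integrally_closed_local.
- exact: ring_with_divisors_local.
Qed.
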